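(* Let $\bar\lambda=\langle\lambda_\alpha:\alpha\le\omega\rangle$ be regular cardinals with $\lambda_n<\lambda_{n+1}<\lambda_\omega$ for all $n<\omega$, and put $\lambda=\lambda_\omega$. Let $D$ be a filter on $\omega$ containing all cobounded sets, and assume ${\rm tcf}(\prod_{n<\omega}\lambda_n/D)=\lambda$ and $(\sum_{n<\omega}\lambda_n)^+<\lambda<\prod_{n<\omega}\lambda_n$. Then there is no universal member in $\mathfrak{K}^{tr}_{\bar\lambda}$.
   Context: ${\rm tcf}(\prod_n\lambda_n/D)=\lambda$ means there is a sequence of length $\lambda$ in $\prod_n\lambda_n$ which is increasing and cofinal under $<_D$ (where $f<_Dg$ iff $\{n:f(n)<g(n)\}\in D$). $\mathfrak{K}^{tr}_{\bar\lambda}$ is the class of trees with $\omega+1$ levels (partial orders with well-ordered sets of predecessors, level ${\rm otp}\{y:y<x\}\le\omega$) such that level $i$ has at most $\lambda_i$ elements; embeddings are one-to-one maps preserving $<$, its negation and levels. A universal member is one into which every member of $\mathfrak{K}^{tr}_{\bar\lambda}$ embeds. *)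

(* Defs.v *)
From mathcomp Require Import all_boot all_order.
From mathcomp Require Import all_classical wochoice.

Set Implicit Arguments.
Unset Strict Implicit.
Unset Printing Implicit Defensive.

Local Open Scope order_scope.
Local Open Scope classical_set_scope.
Local Open Scope card_scope.

Definition card_lt (T U : Type) (A : set T) (B : set U) : bool :=
  (A #<= B) && ~~ (B #<= A).

(* A cardinal is represented by an initial ordinal: a well-ordered type none of
   whose proper initial segments has the cardinality of the whole type.  The
   order matters: it is the one used in the products of the lambda_n and in
   the sequences of length lambda. *)
Record cardinal := Cardinal {
  cardinal_disp : Order.disp_t;
  cardinal_sort :> orderType cardinal_disp;
  cardinal_wo : well_order (<=%O : rel cardinal_sort);
  cardinal_initial : forall x : cardinal_sort,
    card_lt [set y : cardinal_sort | y < x] [set: cardinal_sort]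
}.

Definition cofinal_in (k : cardinal) (A : set k) : Prop :=
  forall x : k, exists2 y, A y & x <= y.

Definition regular (k : cardinal) : Prop :=
  infinite_set [set: k] /\
  forall A : set k, cofinal_in A -> [set: k] #<= A.

(* mu is |S|^+, the least cardinality greater than that of S. *)
Definition is_successor (S : Type) (mu : cardinal) : Prop :=
  card_lt [set: S] [set: mu] /\
  forall (T : Type) (B : set T), card_lt [set: S] B -> [set: mu] #<= B.

Definition cobounded (A : set nat) : Prop :=
  exists m : nat, forall n : nat, (m <= n)%N -> A n.

Definition lt_mod (D : set_system nat) (L : nat -> cardinal)
    (f g : forall n, L n) : Prop :=
  D [set n | f n < g n].

(* tcf (prod_n L n / D) = k *)
Definition tcf_eq (D : set_system nat) (L : nat -> cardinal) (k : cardinal) :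
    Prop :=
  exists F : k -> forall n, L n,
    (forall a b : k, a < b -> lt_mod D (F a) (F b)) /\
    (forall g : forall n, L n, exists a : k, lt_mod D g (F a)).

(* The ordinals i <= omega, and each of them as a set of natural numbers. *)
Inductive level := Fin of nat | Omega.

Definition below (i : level) : set nat :=
  if i is Fin n then [set j | (j < n)%N] else setT.

(* otp {y : y < x} = i, witnessed by an enumeration by i; in particular the
   set of predecessors of x is then well-ordered. *)
Definition at_level (d : Order.disp_t) (T : porderType d) (x : T) (i : level) :
    Prop :=
  exists f : nat -> T,
    {in below i &, {mono f : j k / (j < k)%N >-> j < k}} /\
    f @` below i = [set y | y < x].

Record tree := Tree {
  tree_disp : Order.disp_t;
  tree_sort :> porderType tree_disp;
  tree_level : forall x : tree_sort, exists i : level, at_level x i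
}.

Definition Ktr (lam : level -> cardinal) (T : tree) : Prop :=
  forall i : level, [set x : T | at_level x i] #<= [set: lam i].

Definition tree_embedding (T U : tree) (f : T -> U) : Prop :=
  [/\ injective f,
      {mono f : x y / x < y} &
      forall (x : T) (i : level), at_level x i -> at_level (f x) i].

Definition universal (lam : level -> cardinal) (U : tree) : Prop :=
  Ktr lam U /\
  forall T : tree, Ktr lam T -> exists f : T -> U, tree_embedding f.

(* Main.v *)
(* Write L n for lam_n, Lam for lam_omega, and call f : forall n, L n a position
   function.  An embedding moves positions on each level in a controlled way: for
   some phi n : L n -> L n, a node at position a on level n goes below phi n a,
   and conversely.  A ladder is a sequence of position functions h_i that is
   nondecreasing in i at each coordinate; if phi separates h_i from h_j and h_j
   from h_k at n, the node placed at h_j(n) must land between h_i(n) and h_k(n).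
   So the way in which a top element threads its way through a ladder is an
   invariant of embeddings, and it remains to find a family of at most Lam
   ladders that catches every phi: along each of them there is a way that the top
   elements of the universal tree, being at most Lam many, miss.

   The tcf hypothesis turns phi into a club of Lam, on which a scale F is
   phi-separated modulo D, and the ladders come from guessing that club.  The
   guesses have size less than mu and are stabilised by an iteration of length
   mu; this is where mu < Lam is used.  For h_i to be nondecreasing at every
   coordinate it has to be the pointwise supremum of a piece of the scale, and for
   these suprema to remain below later members of the scale the pieces must be
   foreseen: they are guessed by clubs of mu.

   Separation at each step of a ladder holds only modulo D.  If 2^omega <= Lam,
   there are few enough functions H : nat -> nat to let a top element use the
   k-th term of its pattern at a coordinate H k that is good for that term.
   Otherwise there are more than Lam patterns in nat -> bool, for which ladders of
   countable length suffice, and a club of L 2 is guessed once more to get one set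
   of D on which all steps are good. *)

From HB Require Import structures.
Require Import Defs.
From mathcomp Require Import all_boot all_order.
From mathcomp Require Import all_classical.

Set Implicit Arguments.
Unset Strict Implicit.
Unset Printing Implicit Defensive.

Import Order.TTheory.

Local Open Scope order_scope.
Local Open Scope classical_set_scope.
Local Open Scope card_scope.

(** * Injections between types *)

Definition emb (A B : Type) : Prop := exists f : A -> B, injective f.

Lemma emb_refl A : emb A A.
Proof. by exists id. Qed.

Lemma emb_trans B A C : emb A B -> emb B C -> emb A C.
Proof. by move=> [f fI] [g gI]; exists (g \o f); exact: inj_comp. Qed.

Lemma emb_prod A A' B B' : emb A A' -> emb B B' -> emb (A * B) (A' * B').
Proof.
move=> [f fI] [g gI]; exists (fun p => (f p.1, g p.2)) => -[a b] [a' b'] /=.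
by case=> /fI -> /gI ->.
Qed.

Lemma sval_inj T (A : set T) : injective (@sval T A).
Proof. by move=> x y xy; apply: eq_sig_hprop => // ? ? ?; exact: Prop_irrelevance. Qed.

Lemma emb_sig T (A : set T) : emb {x | A x} T.
Proof. by exists sval; exact: sval_inj. Qed.

Lemma emb_image T U (A : set T) (f : T -> U) :
  emb {y | exists2 x, A x & f x = y} {x | A x}.
Proof.
have H (y : {y | exists2 x, A x & f x = y}) :
    exists x : {x | A x}, f (sval x) = sval y.
  by case: y => y [x Ax xy]; exists (exist _ x Ax).
have /choice[g gP] := H; exists g => y y' yy'.
by apply: sval_inj; rewrite -!gP yy'.
Qed.

Lemma emb_sub T (A B : set T) : A `<=` B -> emb {x | A x} {x | B x}.
Proof.
move=> AB; exists (fun x => exist _ (sval x) (AB _ (svalP x))) => x y [xy].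
by apply: sval_inj.
Qed.

Lemma card_leE T U (A : set T) (B : set U) :
  (A #<= B) <-> emb {x | A x} {y | B y}.
Proof.
split=> [/card_leP[f]|[f fI]].
  have gB (x : {x | A x}) : B (val (f (SigSub (mem_set (svalP x))))).
    exact: set_mem (valP _).
  exists (fun x => exist _ _ (gB x)) => x y [/val_inj fxy].
  have [] := 'inj_f (mem_set I) (mem_set I) fxy.
  by move=> xy; exact: sval_inj.
apply/card_leP/injfunPex.
exists (fun x : A => SigSub (mem_set (svalP (f (exist _ (val x) (set_valP x)))))).
  by [].
move=> x y _ _ [fxy]; apply: val_inj.
suff /fI[] : f (exist _ (val x) (set_valP x)) = f (exist _ (val y) (set_valP y)) by [].
by apply: sval_inj.
Qed.

Lemma emb_full T (A : set T) : (forall x, A x) -> emb T {x | A x}.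
Proof. by move=> AT; exists (fun x => exist _ x (AT x)) => x y [->]. Qed.

Lemma card_leTE T U : ([set: T] #<= [set: U]) <-> emb T U.
Proof.
rewrite card_leE; split=> H.
  apply: emb_trans (emb_sig [set: U]).
  by apply: emb_trans H; exact: emb_full.
by apply: (emb_trans (emb_sig _)); apply: (emb_trans H); exact: emb_full.
Qed.

Lemma card_leTlE T U (B : set U) : ([set: T] #<= B) <-> emb T {y | B y}.
Proof.
rewrite card_leE; split=> H; last exact: (emb_trans (emb_sig _)).
by apply: emb_trans H; exact: emb_full.
Qed.

Lemma card_leTrE T U (A : set T) : (A #<= [set: U]) <-> emb {x | A x} U.
Proof.
rewrite card_leE; split=> H; first exact: (emb_trans H (emb_sig _)).
by apply: (emb_trans H); exact: emb_full.
Qed.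

(* A maximal partial injection is total or onto. *)
Lemma emb_total (A B : Type) : emb A B \/ emb B A.
Proof.
pose P (G : set (A * B)) := (forall a b b', G (a, b) -> G (a, b') -> b = b') /\
  (forall a a' b, G (a, b) -> G (a', b) -> a = a').
have [F FP Ftot|G [[Gf Gi] Gmax]] := @Zorn_bigcup _ P.
  split.
    move=> a b b' [X FX Xb] [Y FY Yb]; have [XY|YX] := Ftot _ _ FX FY.
      by apply: (FP _ FY).1 Yb; exact: XY.
    by apply: (FP _ FX).1 Xb _; exact: YX.
  move=> a a' b [X FX Xb] [Y FY Yb]; have [XY|YX] := Ftot _ _ FX FY.
    by apply: (FP _ FY).2 Yb; exact: XY.
  by apply: (FP _ FX).2 Xb _; exact: YX.
have [/choice[f fG]|/existsNP[a Na]] := pselect (forall a, exists b, G (a, b)).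
  by left; exists f => a a' faa'; apply: Gi (fG a) _; rewrite faa'; exact: fG.
have [/choice[f fG]|/existsNP[b Nb]] := pselect (forall b, exists a, G (a, b)).
  by right; exists f => b b' fbb'; apply: Gf (fG b) _; rewrite fbb'; exact: fG.
exfalso; apply: (Gmax (G `|` [set (a, b)])).
  split=> [x Gx|/(_ (a, b)) H]; first by left.
  by apply: Na; exists b; apply: H; right.
split.
  move=> x y y' [Gy|[xa yb]] [Gy'|[xa' yb']]; subst => //; first exact: Gf Gy Gy'.
    by case: Na; exists y.
  by case: Na; exists y'.
move=> x x' y [Gy|[xa yb]] [Gy'|[xa' yb']]; subst => //; first exact: Gi Gy Gy'.
  by case: Nb; exists x.
by case: Nb; exists x'.
Qed.

Lemma emb_count (C : countType) A : emb nat A -> emb C A.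
Proof. by apply: emb_trans; exists pickle; exact: pcan_inj pickleK. Qed.

Lemma emb_union T (A : set T) R : emb nat R -> emb (R * R) R ->
  emb {x | A x} R -> emb {x | ~ A x} R -> emb T R.
Proof.
move=> natR sqR [f fI] [g gI]; apply: (@emb_trans (R * bool)); last first.
  apply: emb_trans sqR; exact: (emb_prod (emb_refl R) (emb_count _ natR)).
exists (fun x => match pselect (A x) with
  | left Ax => (f (exist _ x Ax), true)
  | right Ax => (g (exist (fun x => ~ A x) x Ax), false) end).
move=> x y; case: pselect => Ax; case: pselect => Ay // [].
  by move=> /fI[].
by move=> /gI[].
Qed.

(* The graph of an injection from A * A to A, where A is the set of the [x] such
   that [G] has a point [(x, x, z)]. *)
Definition square_graph T (G : set (T * T * T)) : Prop :=
  [/\ forall x y z z', G (x, y, z) -> G (x, y, z') -> z = z',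
      forall x y x' y' z, G (x, y, z) -> G (x', y', z) -> (x, y) = (x', y'),
      forall x y, (exists z, G (x, x, z)) -> (exists z, G (y, y, z)) ->
        exists z, G (x, y, z) &
      forall x y z, G (x, y, z) -> [/\ exists t, G (x, x, t),
        exists t, G (y, y, t) & exists t, G (z, z, t)]].

Lemma square_graph_emb T (G : set (T * T * T)) : square_graph G ->
  let R := {x | exists z, G (x, x, z)} in emb (R * R) R.
Proof.
move=> [Gf Gi Gt Gr] R.
have H (p : R * R) : exists z : R, G (sval p.1, sval p.2, sval z).
  case: p => -[x Ax] [y Ay] /=; have [z Gz] := Gt _ _ Ax Ay.
  by have [_ _ Az] := Gr _ _ _ Gz; exists (exist _ z Az).
have [e eG] := choice H; exists e => p q epq.
have := eG p; rewrite epq => /Gi /(_ (eG q)).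
by case: p q {epq} => [p1 p2] [q1 q2] /= [/sval_inj -> /sval_inj ->].
Qed.

(** A disjoint copy of [R] in the complement is adjoined, [v (r, true)] being the copy of [r]. Pairs
    with a new coordinate take new values only, through [code], so no value of [G] is repeated. *)
Lemma square_graph_extend T (G : set (T * T * T)) : square_graph G ->
  let R := {x | exists z, G (x, x, z)} in
  emb nat R -> emb R {x | ~ exists z, G (x, x, z)} ->
  exists H, G `<` H /\ square_graph H.
Proof.
move=> GP R natR [c cI].
have sqR : emb (R * R) R := square_graph_emb GP.
have [code codeI] : emb (R * R * (bool * bool)) R.
  by apply: (emb_trans _ sqR); apply: (emb_prod sqR); exact: emb_count.
pose v (p : R * bool) : T := if p.2 then sval (c p.1) else sval p.1.
have vI : injective v.
  move=> [r t] [s u]; rewrite /v /=; case: t; case: u => vv.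
  - by congr (_, _); apply/cI/sval_inj.
  - by case: (svalP (c r)); rewrite vv; exact: svalP s.
  - by case: (svalP (c s)); rewrite -vv; exact: svalP r.
  - by congr (_, _); apply/sval_inj.
have vT r : ~ exists z, G (v (r, true), v (r, true), z) by exact: svalP (c r).
case: (GP) => Gf Gi Gt Gr.
pose N x y z := exists r s t u, [/\ t || u, x = v (r, t), y = v (s, u) &
  z = v (code (r, s, (t, u)), true)].
pose H : set (T * T * T) := [set p | G p \/ N p.1.1 p.1.2 p.2].
have HA x : (exists z, H (x, x, z)) <-> exists p, x = v p.
  split=> [[z [/Gr[xA _ _]|[r [_ [t [_ [_ /= -> _ _]]]]]]]|[[r [] ->]]].
  - by exists (exist _ x xA, false).
  - by exists (r, t).
  - by exists (v (code (r, r, (true, true)), true)); right; exists r, r, true, true.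
  - by have [z Gz] := svalP r; exists z; left.
have NG x y z : N x y z -> ~ ((exists t, G (x, x, t)) /\ (exists t, G (y, y, t))).
  by move=> [r [s [[] [[] [//= _ -> -> _]]]]] [] A1 A2; first [exact: vT A1|exact: vT A2].
exists H; split.
  split; first by move=> p Gp; left.
  move=> /(_ (_, _, _)) HG; have [f _] := natR; pose r := f 0%N.
  have /HG/Gr[/vT//] : H (v (r, true), v (r, true), v (code (r, r, (true, true)), true)).
  by right; exists r, r, true, true.
split.
- move=> x y z z' [] /= Gz [] /= Gz'; first exact: Gf Gz Gz'.
  + by case: (NG _ _ _ Gz'); have [] := Gr _ _ _ Gz.
  + by case: (NG _ _ _ Gz); have [] := Gr _ _ _ Gz'.
  + case: Gz Gz' => r [s [t [u [_ -> -> ->]]]] [r' [s' [t' [u' [_ /vI E /vI E' ->]]]]].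
    by case: E E' => -> -> [-> ->].
- move=> x y x' y' z [] /= Gz [] /= Gz'; first exact: Gi Gz Gz'.
  + case: Gz' Gz => r [s [t [u [_ _ _ ->]]]] /Gr[_ _ /vT//].
  + case: Gz Gz' => r [s [t [u [_ _ _ ->]]]] /Gr[_ _ /vT//].
  + case: Gz Gz' => r [s [t [u [_ -> -> ->]]]] [r' [s' [t' [u' [_ -> -> /vI[]]]]]].
    by move=> /codeI[-> -> -> ->].
- move=> _ _ /HA[[r t] ->] /HA[[s u] ->].
  have [tu|] := boolP (t || u).
    by exists (v (code (r, s, (t, u)), true)); right; exists r, s, t, u.
  case: t; case: u => // _; have [z Gz] := Gt _ _ (svalP r) (svalP s).
  by exists z; left.
- move=> x y z [] /= Gz.
    have [xA yA zA] := Gr _ _ _ Gz.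
    by split; apply/HA; [exists (exist _ x xA, false)|exists (exist _ y yA, false)|
      exists (exist _ z zA, false)].
  case: Gz => r [s [t [u [_ -> -> ->]]]].
  by split; apply/HA; eexists; reflexivity.
Qed.

Lemma emb_square T : emb nat T -> emb (T * T) T.
Proof.
move=> [i iI].
pose G0 : set (T * T * T) :=
  [set (i p.1, i p.2, i (pickle p)) | p in [set: nat * nat]].
have G0d n : G0 (i n, i n, i (pickle (n, n))) by exists (n, n).
have G0P : square_graph G0.
  split.
  - by move=> _ _ _ z [[a b] _ [<- <- <-]] [[a' b'] _ [/iI -> /iI -> <-]].
  - move=> x y x' y' z [[a b] _ [<- <- <-]] [[a' b'] _ [<- <-]].
    by move=> /iI /(pcan_inj pickleK) [-> ->].
  - move=> _ _ [_ [[a b] _ [<- _ _]]] [_ [[a' b'] _ [<- _ _]]].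
    by exists (i (pickle (a, a'))); exists (a, a').
  - by move=> _ _ _ [[a b] _ [<- <- <-]]; split; eexists; exact: G0d.
(* The empty chain must satisfy the Zorn predicate too, so [G0] is joined to every candidate. *)
have [F FP Ftot|G [GP Gmax]] := @Zorn_bigcup _ (fun G => square_graph (G0 `|` G)).
  have UP p q : (G0 `|` \bigcup_(X in F) X) p -> (G0 `|` \bigcup_(X in F) X) q ->
      exists X, [/\ square_graph (G0 `|` X), (G0 `|` X) p, (G0 `|` X) q &
        X `<=` \bigcup_(X in F) X].
    move=> [Gp|[X FX Xp]] [Gq|[Y FY Yq]].
    - by exists set0; split=> //; [rewrite setU0|left|left].
    - by exists Y; split; [exact: FP|left|right|exact: bigcup_sup].
    - by exists X; split; [exact: FP|right|left|exact: bigcup_sup].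
    - have [XY|YX] := Ftot _ _ FX FY.
        by exists Y; split; [exact: FP|right; exact: XY|right|exact: bigcup_sup].
      by exists X; split; [exact: FP|right|right; exact: YX|exact: bigcup_sup].
  have lift X z : X `<=` \bigcup_(X in F) X ->
      (G0 `|` X) z -> (G0 `|` \bigcup_(X in F) X) z.
    by move=> XU [?|/XU ?]; [left|right].
  split.
  - by move=> x y z z' p q; have [X [[Xf _ _ _] Xp Xq _]] := UP _ _ p q; exact: Xf Xp Xq.
  - by move=> x y x' y' z p q; have [X [[_ Xi _ _] Xp Xq _]] := UP _ _ p q; exact: Xi Xp Xq.
  - move=> x y [z p] [t q]; have [X [[_ _ Xt _] Xp Xq XU]] := UP _ _ p q.
    have [|//|w Xw] := Xt x y _ _; [by exists z|by exists t|].
    by exists w; exact: lift _ _ XU Xw.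
  - move=> x y z p; have [X [[_ _ _ Xr] Xp _ XU]] := UP _ _ p p.
    have [[a Xa] [b Xb] [c Xc]] := Xr _ _ _ Xp.
    by split; [exists a|exists b|exists c]; exact: lift XU _.
pose G1 : set (T * T * T) := G0 `|` G; pose R := {x : T | exists z, G1 (x, x, z)}.
have natR : emb nat R.
  have iR n : exists z, G1 (i n, i n, z) by eexists; left; exact: G0d.
  by exists (fun n => exist _ (i n) (iR n) : R) => m n [/iI].
have sqR : emb (R * R) R := square_graph_emb GP.
have TR : emb T R.
  have [RC|CR] := emb_total R {x | ~ exists z, G1 (x, x, z)}.
    have [H [[GH nHG] HP]] := square_graph_extend GP natR RC.
    exfalso; apply: (Gmax H); last first.
      suff -> : G0 `|` H = H by [].
      by apply/setUidPr => p Gp; apply: GH; left.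
    split; first by move=> p Gp; apply: GH; right.
    by move=> HG; apply: nHG => p /HG Gp; right.
  exact: (emb_union natR sqR (emb_refl _) CR).
exact: (emb_trans (emb_prod TR TR) (emb_trans sqR (emb_sig _))).
Qed.

(** * Regular cardinals, clubs and normal chains *)

Lemma wo_least (W : cardinal) (P : set W) :
  (exists x, P x) -> exists x, P x /\ forall y, P y -> x <= y.
Proof.
move=> [x Px]; have [|z [[/asboolP Pz zP] _]] := cardinal_wo (A := fun x => `[< P x >]).
  by exists x; apply/asboolP.
by exists z; split=> // y Py; apply: zP; apply/asboolP.
Qed.

Lemma wf_lt (W : cardinal) : well_founded (fun x y : W => x < y).
Proof.
move=> x; have [//|nA] := pselect (Acc (fun x y : W => x < y) x).
have [y [nAy ymin]] := @wo_least W (fun x => ~ Acc (fun x y : W => x < y) x)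
  (ex_intro _ x nA).
case: nAy; constructor => z zy; have [//|nAz] := pselect (Acc (fun x y : W => x < y) z).
by have := ymin _ nAz; rewrite leNgt zy.
Qed.

Lemma seg_small (W : cardinal) (i : W) : ~ emb W {j | j < i}.
Proof.
have /andP[_ /negP H] := cardinal_initial i.
by move=> /card_leTlE; exact: H.
Qed.

Lemma emb_seg (W : cardinal) (i : W) : emb {j | j < i} W.
Proof. exact: emb_sig. Qed.

Section Regular.
Variable W : cardinal.
Hypothesis W_reg : regular W.

Lemma reg_inf : emb nat W.
Proof. by have [/infiniteP/card_leTE] := W_reg. Qed.

Lemma reg_ge_bound (A : set W) : ~ emb W {x | A x} ->
  exists x, forall y, A y -> y < x.
Proof.
move=> WA; apply/not_existsP => nb; apply: WA; apply/card_leTlE.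
have [_] := W_reg; apply => x; have := nb x.
by move=> /existsNP[y /not_implyP[Ay /negP]]; rewrite -leNgt; exists y.
Qed.

Lemma reg_bound I (f : I -> W) : ~ emb W I -> exists x, forall i, f i < x.
Proof.
move=> WI; have [|x xP] := @reg_ge_bound (range f).
  move=> H; apply: WI; apply: (emb_trans H).
  have /choice[g gP] : forall y : {x | range f x}, exists i, f i = sval y.
    by move=> y; have [i _ iy] := svalP y; exists i.
  by exists g => y y' yy'; apply: sval_inj; rewrite -!gP yy'.
by exists x => i; apply: xP; exists i.
Qed.

Lemma reg_bound2 I (J : I -> Type) (f : forall i, J i -> W) :
  ~ emb W I -> (forall i, ~ emb W (J i)) -> exists x, forall i j, f i j < x.
Proof.
move=> WI WJ.
have /choice[g gP] : forall i, exists x, forall j, f i j < x.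
  by move=> i; exact: reg_bound.
have [x xP] := reg_bound g WI; exists x => i j.
exact: lt_trans (gP i j) (xP i).
Qed.

Lemma reg_nonempty : exists x : W, True.
Proof. by have [f _] := reg_inf; exists (f 0%N). Qed.

Lemma reg_gt (x : W) : exists y, x < y.
Proof.
have [|y /(_ tt)] := @reg_bound unit (fun=> x); last by exists y.
move=> H; have [f fI] := emb_trans reg_inf H.
by have /fI : f 0%N = f 1%N by case: (f 0%N) (f 1%N) => -[].
Qed.

Lemma reg_sup I (f : I -> W) : ~ emb W I ->
  exists x, (forall i, f i < x) /\ forall y, y < x -> exists i, y <= f i.
Proof.
move=> /(reg_bound f)/wo_least[x [fx xmin]]; exists x; split=> // y yx.
apply/not_existsP => H; have : x <= y.
  by apply: xmin => i; rewrite ltNge; apply/negP/H.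
by rewrite leNgt yx.
Qed.

End Regular.

Definition closure_pts (W : cardinal) (psi : W -> W) : set W :=
  [set x | forall y, y < x -> psi y < x].

(* Clubs are handled through functions: on a regular uncountable cardinal every
   closed unbounded set contains the closure points of some function. *)
Definition club (W : cardinal) (E : set W) : Prop :=
  exists psi : W -> W, closure_pts psi `<=` E.

Lemma club_sub (W : cardinal) (E F : set W) : club E -> E `<=` F -> club F.
Proof. by move=> [psi EP] EF; exists psi => x /EP/EF. Qed.

Section Club.
Variable W : cardinal.
Hypothesis W_reg : regular W.

Lemma club_inter I (E : I -> set W) : ~ emb W I -> (forall i, club (E i)) ->
  club [set x | forall i, E i x].
Proof.
move=> WI /choice[psi psiE].
have /choice[phi phiP] : forall x, exists y, forall i, psi i x < y.
  by move=> x; exact: reg_bound.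
exists phi => x xP i; apply: psiE => y yx; exact: lt_trans (phiP y i) (xP y yx).
Qed.

Lemma club_gt (E : set W) : ~ emb W nat -> club E ->
  forall x, exists y, E y /\ x < y.
Proof.
move=> Wnat [psi psiE] x.
have /choice[g gP] : forall z, exists t, z < t /\ forall y, y < z -> psi y < t.
  move=> z; have [t tP] := reg_bound W_reg (fun y : {y | y < z} => psi (sval y))
    (@seg_small W z).
  have [u zu] := reg_gt W_reg z; exists (Order.max t u).
  rewrite lt_max zu orbT; split=> // y yz; rewrite lt_max.
  by rewrite (tP (exist _ y yz)).
(* Any [y] below the supremum of the iterates is overtaken at some stage, and [psi y] soon after. *)
have [s [sP smin]] := reg_sup W_reg (fun n => iter n g x) Wnat.
exists s; split; last exact: (sP 0%N).
apply: psiE => y /smin[n yn]; have [lt_g ltg] := gP (iter n.+1 g x).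
apply: lt_trans (ltg y _) (sP n.+2); apply: le_lt_trans yn _.
exact: (gP (iter n g x)).1.
Qed.

End Club.

(** Recursion without dependent types: [F] is given the values below [i], and [w0] everywhere
    else. *)
Lemma wf_rec (V : cardinal) (W : Type) (w0 : W) (F : (V -> W) -> V -> W) :
  exists d : V -> W, forall i, d i = F (fun k => if k < i then d k else w0) i.
Proof.
pose step i (rec : forall j, j < i -> W) :=
  F (fun k => if pselect (k < i) is left h then rec k h else w0) i.
exists (Fix (@wf_lt V) (fun _ => W) step) => i.
rewrite Fix_eq; last first.
  move=> x f g fg; congr (F _ x); apply/funext => k.
  by case: pselect => // h; exact: fg.
congr (F _ i); apply/funext => k; case: pselect => [->//|/negP/negbTE -> //].
Qed.

Section Chain.
Variables (V W : cardinal).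
Hypothesis W_reg : regular W.
Hypothesis seg_lt : forall i : V, ~ emb W {j | j < i}.

(** [R d j x] is a demand that the values of [d] up to [j] make on every later value. *)
Lemma rec_chain (E : set W) (R : (V -> W) -> V -> W -> Prop) :
  (forall x, exists y, E y /\ x < y) ->
  (forall d d' j x, (forall k, k <= j -> d k = d' k) -> R d j x -> R d' j x) ->
  (forall d j x y, x <= y -> R d j x -> R d j y) ->
  (forall d j, exists x, R d j x) ->
  exists d : V -> W, [/\ forall i, E (d i),
    forall j i, j < i -> d j < d i /\ R d j (d i) &
    forall i x, E x -> (forall j, j < i -> d j < x /\ R d j x) -> d i <= x].
Proof.
move=> Egt Rext Rup Rex; have [w0 _] := reg_nonempty W_reg.
pose Q (e : V -> W) (i : V) : set W :=
  [set x | E x /\ forall j, j < i -> e j < x /\ R e j x].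
have Qex e i : exists x, Q e i x /\ forall y, Q e i y -> x <= y.
  apply: wo_least.
  have /choice[g gP] : forall j, exists x, e j < x /\ R e j x.
    move=> j; have [x Rx] := Rex e j; have [y jy] := reg_gt W_reg (e j).
    exists (Order.max x y); rewrite lt_max jy orbT; split=> //.
    by apply: Rup Rx; rewrite le_max lexx.
  have [x xP] := reg_bound W_reg (fun j : {j | j < i} => g (sval j)) (@seg_lt i).
  have [y [Ey xy]] := Egt x; exists y; split=> // j ji.
  have gy : g j < y := lt_trans (xP (exist _ j ji)) xy.
  by split; [exact: lt_trans (gP j).1 gy|exact: Rup (ltW gy) (gP j).2].
have /choice[F FP] : forall p : (V -> W) * V,
    exists x, Q p.1 p.2 x /\ forall y, Q p.1 p.2 y -> x <= y by move=> p; exact: Qex.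
have [d dP] := wf_rec w0 (fun e i => F (e, i)).
have dQ i : Q d i = Q (fun k => if k < i then d k else w0) i.
  apply/predeqP => x; split=> -[Ex xP]; split=> // j ji; have [lt_x Rx] := xP j ji.
    rewrite ji; split=> //; apply: Rext Rx => k kj.
    by rewrite (le_lt_trans kj ji).
  rewrite ji in lt_x; split=> //; apply: Rext Rx => k kj.
  by rewrite (le_lt_trans kj ji).
have {dP FP} dP i : Q d i (d i) /\ forall y, Q d i y -> d i <= y.
  by rewrite dQ dP; exact: (FP (_, _)).
exists d; split.
- by move=> i; have [[]] := dP i.
- by move=> j i; have [[_ H] _] := dP i; exact: H.
- by move=> i x Ex xP; apply: (dP i).2.
Qed.

(** At the least index both premises of the second clause are vacuous, so a normal chain starts at
    the least element of [W]. *)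
Definition normal (d : V -> W) : Prop :=
  (forall j i, j < i -> d j < d i) /\
  forall i x, (forall j, j < i -> exists k, j < k /\ k < i) ->
    (forall j, j < i -> d j <= x) -> d i <= x.

(* Being the least possible value, [d i] is at a limit [i] the supremum of the
   previous ones, since closure points are closed under suprema. *)
Lemma rec_normal (psi : W -> W) (R : (V -> W) -> V -> W -> Prop) :
  ~ emb W nat ->
  (forall d d' j x, (forall k, k <= j -> d k = d' k) -> R d j x -> R d' j x) ->
  (forall d j x y, x <= y -> R d j x -> R d j y) ->
  (forall d j, exists x, R d j x) ->
  exists d : V -> W, [/\ normal d, forall i, closure_pts psi (d i) &
    forall j i, j < i -> R d j (d i)].
Proof.
move=> Wnat Rext Rup Rex.
have [|d [dE dR dmin]] := @rec_chain (closure_pts psi) R _ Rext Rup Rex.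
  by apply: club_gt => //; exists psi.
exists d; split=> // [|j i /dR[]//]; split=> [j i /dR[]//|i x ilim xub].
have [s [sub smin]] : exists s, (forall j, j < i -> d j <= s) /\
    forall y, (forall j, j < i -> d j <= y) -> s <= y.
  by apply: wo_least; exists x.
apply: le_trans (smin _ xub); apply: dmin.
  move=> y ys; have [k [ki yk]] : exists k, k < i /\ y < d k.
    apply/not_existsP => H; have : s <= y.
      apply: smin => j ji; rewrite leNgt; apply/negP => yj; apply: (H j); split => //.
    by rewrite leNgt ys.
  by apply: lt_le_trans (sub k ki); exact: dE.
move=> j ji; have [k [jk ki]] := ilim j ji; have [jdk Rk] := dR j k jk.
by split; [exact: lt_le_trans jdk (sub k ki)|exact: Rup (sub k ki) Rk].
Qed.

End Chain.

(** Two normal chains with the same supremum overtake each other again and again, hence agree on a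
    club. So one chain for each supremum [s] is enough. *)
Lemma normal_family (V W : cardinal) : regular V -> regular W -> ~ emb W V ->
  exists e : W -> V -> W, forall d, normal d ->
    exists s, club [set i | e s i = d i].
Proof.
move=> V_reg W_reg WV.
pose S s (d : V -> W) := normal d /\ (forall i, d i < s) /\
  forall y, y < s -> exists i, y <= d i.
have [w0 _] := reg_nonempty W_reg.
have /choice[e eP] : forall s, exists e, (exists d, S s d) -> S s e.
  move=> s; have [[d Sd]|H] := pselect (exists d, S s d); first by exists d.
  by exists (fun=> w0).
exists e => d dn; have [s [ds smin]] := reg_sup W_reg d WV; exists s.
have [|en [es emin]] := eP s; first by exists d.
have step (f g : V -> W) : normal g -> (forall i, f i < s) ->
    (forall y, y < s -> exists i, y <= g i) -> forall i, exists k, f i < g k.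
  move=> gn fs gmin i; have [k fk] := gmin _ (fs i); have [l kl] := reg_gt V_reg k.
  by exists l; exact: le_lt_trans fk (gn.1 k l kl).
have /choice[psi psiP] : forall i, exists k, [/\ i < k, e s i < d k & d i < e s k].
  move=> i; have [k ek] := step _ _ dn es smin i.
  have [l dl] := step _ _ en ds emin i; have [m im] := reg_gt V_reg i.
  exists (Order.max m (Order.max k l)); rewrite lt_max im; split=> //.
    apply: lt_le_trans ek _; have : k <= Order.max m (Order.max k l).
      by rewrite !le_max lexx /= orbT.
    by rewrite le_eqVlt => /orP[/eqP <-//|/dn.1/ltW].
  apply: lt_le_trans dl _; have : l <= Order.max m (Order.max k l).
    by rewrite !le_max lexx !orbT.
  by rewrite le_eqVlt => /orP[/eqP <-//|/en.1/ltW].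
exists psi => i ip /=.
have ilim j : j < i -> exists k, j < k /\ k < i.
  by move=> ji; exists (psi j); split; [have [] := psiP j|exact: ip].
apply/eqP; rewrite eq_le; apply/andP; split.
  apply: en.2 => // j ji; have [_ + _] := psiP j; move/lt_trans => H.
  by apply: ltW; apply: H; apply: dn.1; exact: ip.
apply: dn.2 => // j ji; have [_ _] := psiP j; move/lt_trans => H.
by apply: ltW; apply: H; apply: en.1; exact: ip.
Qed.

(** * Guessing clubs *)

(* If no [E0] works, each candidate is refuted by some set of the family; the
   refutations iterated along [Th] stabilise on each of the small sets [Z t],
   and the stable value is not refuted at the next step. *)
Lemma guessing (Th : cardinal) (Y T : Type) (Z : T -> set Y)
    (Cl Good : set Y -> Prop) : regular Th ->
  (forall (B : set Th) (E : Th -> set Y), (forall i, B i -> Cl (E i)) ->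
    Cl [set y | forall i, B i -> E i y]) ->
  (forall t, ~ emb Th {y | Z t y}) ->
  (forall E, Cl E -> exists t, Good (Z t `&` E)) ->
  exists E0, Cl E0 /\
    forall E, Cl E -> exists t, Good (Z t `&` E0) /\ Z t `&` E0 `<=` E.
Proof.
move=> Th_reg Clcap Zsmall Gex; apply/not_existsP => H.
have /choice[adv advP] : forall E0, exists E, Cl E0 -> Cl E /\
    forall t, Good (Z t `&` E0) -> ~ (Z t `&` E0 `<=` E).
  move=> E0; have [C0|nC0] := pselect (Cl E0); last by exists E0.
  have /not_andP[//|/existsNP[E /not_implyP[CE nE]]] := H E0.
  by exists E => _; split=> // t Gt tE; apply: nE; exists t.
have [E E_eq] := wf_rec setT
  (fun (e : Th -> set Y) i => adv [set y | forall j, j < i -> e j y]).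
have {}E_eq i : E i = adv [set y | forall j, j < i -> E j y].
  rewrite {1}E_eq; congr adv; apply/predeqP => y.
  by split=> yE j ji; have := yE j ji; rewrite ji.
have CE i : Cl (E i).
  elim/(well_founded_ind (@wf_lt Th)): i => i IH; rewrite E_eq.
  by have [] := advP _ (Clcap [set j | j < i] E IH).
have [t Gt] := Gex _ (Clcap setT E (fun i _ => CE i)).
have [i0 _] := reg_nonempty Th_reg.
have /choice[out outP] : forall y, exists i, (exists i, ~ E i y) -> ~ E i y.
  by move=> y; have [[i Ei]|?] := pselect (exists i, ~ E i y); [exists i|exists i0].
have [x xP] := reg_bound Th_reg (fun y : {y | Z t y} => out (sval y)) (Zsmall t).
have inE y : Z t y -> (forall j, j < x -> E j y) -> forall i, E i y.
  move=> Zy yE; apply: contrapT => /existsNP /outP; apply; apply: yE.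
  exact: (xP (exist _ y Zy)).
have ZE : Z t `&` [set y | forall j, j < x -> E j y] =
    Z t `&` [set y | forall i, setT i -> E i y].
  apply/predeqP => y; split=> -[Zy yE]; split=> // i _; last exact: yE.
  exact: inE.
have [_ /(_ t)] := advP _ (Clcap [set j | j < x] E (fun i _ => CE i)).
by rewrite ZE -E_eq; apply=> // y [_ yE]; exact: yE.
Qed.

Lemma small_emb W A B : ~ emb W A -> emb B A -> ~ emb W B.
Proof. by move=> WA BA WB; apply: WA; exact: emb_trans WB BA. Qed.

Lemma club_cap (W : cardinal) (I : Type) (B : set I) (E : I -> set W) :
  regular W -> ~ emb W I -> (forall i, B i -> club (E i)) ->
  club [set y | forall i, B i -> E i y].
Proof.
move=> W_reg WI CE.
apply: club_sub (@club_inter W W_reg {i | B i} (fun i => E (sval i)) _ _) _.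
- exact: small_emb WI (emb_sig _).
- by move=> i; apply: CE; exact: svalP.
- by move=> y yE i Bi; exact: (yE (exist _ i Bi)).
Qed.

(** The candidates are proper initial segments of the chains [e s], smaller than [Th], so [guessing]
    applies with [Th] steps. A normal chain inside the given club agrees with some [e s] on a club
    of [Th], and a bounded part of that club has length [K]. *)
Lemma club_guessing (K Th W : cardinal) : regular Th -> regular W ->
  ~ emb W Th -> ~ emb Th K -> ~ emb Th nat ->
  exists a : W * Th -> K -> W, (forall s i j, i <= j -> a s i <= a s j) /\
    forall I, club I -> exists s,
      (forall i j, i < j -> a s i < a s j) /\ forall i, I (a s i).
Proof.
move=> Th_reg W_reg WTh ThK Thnat.
have Wnat : ~ emb W nat by exact: small_emb WTh (reg_inf Th_reg).
have [e eP] := normal_family Th_reg W_reg WTh.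
pose Z (s : W * Th) := [set e s.1 i | i in [set i | i < s.2]].
pose Good (A : set W) := exists a : K -> W,
  (forall i j, i < j -> a i < a j) /\ forall i, A (a i).
have [| | |E0 [_ E0P]] := @guessing Th W (W * Th)%type Z (@club W) Good Th_reg.
- by move=> B E; apply: club_cap.
- move=> s; apply: small_emb (@seg_small Th s.2) _.
  exact: (emb_image [set i | i < s.2]).
- move=> E [psi psiE].
  have [| | | |d [dn dE _]] := @rec_normal Th W W_reg _ psi (fun _ _ _ => True) Wnat.
  + by move=> i; apply: small_emb WTh (emb_seg _).
  + by [].
  + by [].
  + by move=> _ _; have [w _] := reg_nonempty W_reg; exists w.
  have [s Is] := eP d dn.
  have [| | | |b [bI bP _]] := @rec_chain K Th Th_reg _ _ (fun _ _ _ => True)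
    (club_gt Th_reg Thnat Is).
  + by move=> i; apply: small_emb ThK (emb_seg _).
  + by [].
  + by [].
  + by move=> _ _; have [w _] := reg_nonempty Th_reg; exists w.
  have [g gP] := reg_bound Th_reg b ThK.
  exists (s, g); exists (d \o b); split=> [i j /bP[/dn.1]//|i].
  by split; [exists (b i); [exact: gP|exact: bI]|exact/psiE/dE].
(* Indices that guess nothing get a constant sequence, so that monotonicity holds for every [s]. *)
have /choice[a aP] : forall s, exists a : K -> W,
    (forall i j, i <= j -> a i <= a j) /\ (Good (Z s `&` E0) ->
    (forall i j, i < j -> a i < a j) /\ forall i, (Z s `&` E0) (a i)).
  move=> s; have [[a [aI aE]]|?] := pselect (Good (Z s `&` E0)).
    exists a; split=> // i j; rewrite le_eqVlt => /orP[/eqP->//|/aI/ltW//].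
  by have [w _] := reg_nonempty W_reg; exists (fun=> w).
exists a; split=> [s|I /E0P[s [/(aP s).2[aI aE] EI]]]; first exact: (aP s).1.
by exists s; split=> // i; exact/EI/aE.
Qed.

(** * Ladders from a scale *)

Section Scale.
Variables (L : nat -> cardinal) (Lam V : cardinal) (D : set_system nat).
Hypothesis L_reg : forall n, regular (L n).
Hypothesis Lam_reg : regular Lam.
Hypothesis V_reg : regular V.
Hypothesis L_lt : forall m n, (m < n)%N -> ~ emb (L n) (L m).
Hypothesis L_nat : forall n, ~ emb (L n.+1) nat.
Hypothesis L_V : forall n, emb (L n) V.
Hypothesis V_L : forall n, ~ emb V (L n).
Hypothesis Lam_V : ~ emb Lam V.
Hypothesis D_filter : ProperFilter D.
Hypothesis D_cobounded : forall A : set nat, cobounded A -> D A.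
Variable F : Lam -> forall n, L n.
Hypothesis F_incr : forall a b, a < b -> lt_mod D (F a) (F b).
Hypothesis F_cof : forall g : forall n, L n, exists a, lt_mod D g (F a).

Let is_lub (W : cardinal) (A : set W) (x : W) :=
  (forall y, A y -> y <= x) /\ forall z, (forall y, A y -> y <= z) -> x <= z.

(* At a coordinate where the values are unbounded, [xget] returns [F w0 n]. *)
Definition hull (w0 : Lam) (A : set Lam) : forall n, L n :=
  fun n => xget (F w0 n) (is_lub [set F a n | a in A]).

Lemma hullP w0 (A : set Lam) n : ~ emb (L n) {a | A a} ->
  (forall a, A a -> F a n <= hull w0 A n) /\
  forall z, (forall a, A a -> F a n <= z) -> hull w0 A n <= z.
Proof.
move=> nA; have /xgetPex H : exists x, is_lub [set F a n | a in A] x.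
  apply: wo_least.
  have [x xP] := reg_bound (L_reg n) (fun a : {a | A a} => F (sval a) n) nA.
  by exists x => _ [a Aa <-]; exact: ltW (xP (exist _ a Aa)).
have [ub least] := H (F w0 n); split=> [a Aa|z zP]; first by apply: ub; exists a.
by apply: least => _ [a Aa <-]; exact: zP.
Qed.

Lemma hull_le w0 (A B : set Lam) n : ~ emb (L n) {a | B a} -> A `<=` B ->
  hull w0 A n <= hull w0 B n.
Proof.
move=> nB AB; have nA : ~ emb (L n) {a | A a} by exact: small_emb nB (emb_sub AB).
have [ub _] := hullP w0 nB; have [_] := hullP w0 nA; apply => a /AB; exact: ub.
Qed.

Lemma Lam_nat : ~ emb Lam nat.
Proof. exact: small_emb Lam_V (reg_inf V_reg). Qed.

Lemma V_nat : ~ emb V nat.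
Proof. exact: (small_emb (@V_L 0%N) (reg_inf (L_reg 0%N))). Qed.

Lemma image_small k n (B : set (L k)) (b : L k -> Lam) : (k < n)%N ->
  ~ emb (L n) {a | [set b i | i in B] a}.
Proof.
move=> kn; apply: (small_emb (L_lt kn)).
exact: emb_trans (emb_image B b) (emb_sig _).
Qed.

(** The rungs are the hulls of the initial segments of [a]. Asking for some [b < a j] leaves room to
    pass from [b] to [psi b] when [a j] is a closure point of [psi]. *)
Definition good_ladders (w0 : Lam) (A : set Lam) : Prop :=
  forall k, exists a : L k -> Lam, [/\ forall i j, i < j -> a i < a j,
    forall i, A (a i) &
    forall i j, i < j -> exists b, b < a j /\
      lt_mod D (hull w0 [set a i' | i' in [set i' | i' <= i]]) (F b)].

(* [e t] is a fixed chain with supremum [t].  Given a club [E], build a chain [d] in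
   [E] whose members dominate the hulls of all the guesses [a k s] so far; it agrees
   with [e t] on a club of [V], which contains the range of some [a k s]. *)
Lemma good_ladders_exist (w0 : Lam) : exists Z : Lam * V -> set Lam,
  (forall t, ~ emb V {y | Z t y}) /\
  forall E, club E -> exists t, good_ladders w0 (Z t `&` E).
Proof.
have CG k := @club_guessing (L k) (L k.+1) V (L_reg k.+1) V_reg (@V_L k.+1)
  (L_lt (ltnSn k)) (@L_nat k).
pose a k := sval (cid (CG k)).
have aP k : forall I, club I -> exists s,
    (forall i j, i < j -> a k s i < a k s j) /\ forall i, I (a k s i).
  by rewrite /a; case: cid => ? [].
have [e eP] := normal_family V_reg Lam_reg Lam_V.
exists (fun t => [set e t.1 i | i in [set i | i < t.2]]); split.
  move=> t; apply: small_emb (@seg_small V t.2) _.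
  exact: (emb_image [set i | i < t.2]).
move=> E [psi psiE].
(* Only the terms of a guess up to [j] occur, so the demand concerns values of [d] already built. *)
pose R (d : V -> Lam) (j : V) (x : Lam) := forall k s, exists b, b < x /\
  lt_mod D (hull w0 [set d (a k s i) | i in [set i | a k s i <= j]]) (F b).
have [| | | |d [dn dE dR]] := @rec_normal V Lam Lam_reg _ psi R Lam_nat.
- by move=> i; exact: small_emb Lam_V (emb_seg _).
- move=> d d' j x dd' Rx k s; have [b [bx bP]] := Rx k s; exists b; split=> //.
  congr (lt_mod D (hull w0 _) _): bP; apply/predeqP => y.
  by split=> -[i ij <-]; exists i => //; rewrite dd'.
- move=> d j x y xy Rx k s; have [b [bx bP]] := Rx k s.
  by exists b; split=> //; exact: lt_le_trans bx xy.
- move=> d j; have /choice[g gP] : forall p : {k & (V * L k.+1)%type}, exists b,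
      lt_mod D (hull w0 [set d (a (projT1 p) (projT2 p) i) |
        i in [set i | a (projT1 p) (projT2 p) i <= j]]) (F b).
    by move=> p; exact: F_cof.
  have [| |x xP] := @reg_bound2 Lam Lam_reg nat (fun k => (V * L k.+1)%type)
      (fun k s => g (existT _ k s)).
  + exact: Lam_nat.
  + move=> k; apply: small_emb Lam_V _; apply: emb_trans (emb_square (reg_inf V_reg)).
    exact: emb_prod (emb_refl _) (L_V _).
  + by exists x => k s; exists (g (existT _ k s)); split=> //; exact: gP (existT _ k s).
have [t edt] := eP d dn.
have sP k := cid (aP k _ edt).
(* A single bound in [V] for all [k], so that one index [(t, g)] serves the ladders of every
   length. *)
have [| |g gP] := @reg_bound2 V V_reg nat L (fun k i => a k (sval (sP k)) i).
- exact: V_nat.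
- exact: V_L.
exists (t, g) => k; have [sI sE] := svalP (sP k).
exists (fun i => d (a k (sval (sP k)) i)); split.
- by move=> i j /sI; exact: dn.1.
- move=> i; split; last exact/psiE/dE.
  by exists (a k (sval (sP k)) i); [exact: gP|exact: sE].
- move=> i j ij; have [b [bj bP]] := dR _ _ (sI i j ij) k (sval (sP k)).
  exists b; split=> //; congr (lt_mod D (hull w0 _) _): bP; apply/predeqP => y.
  suff le_a i' : (a k (sval (sP k)) i' <= a k (sval (sP k)) i) = (i' <= i).
    by split=> -[i' /= ii' <-]; exists i' => //=; rewrite ?le_a // -le_a.
  by apply: le_mono => x z /sI.
Qed.

(** Choose [psi] with [phi] of [F a] below [F (psi a)] modulo [D] and guess its closure points.
    Modulo [D], [phi] of the [i]-th hull is then at most [phi] of some [F c], which is below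
    [F (psi c)], hence below the [j]-th member of the scale piece and its hull. *)
Lemma ladder_guessing :
  exists h : Lam * V -> forall k, L k -> forall n, L n,
    (forall u k n i j, (k < n)%N -> i <= j -> h u k i n <= h u k j n) /\
    forall phi : forall n, L n -> L n,
      (forall n x y, x <= y -> phi n x <= phi n y) ->
      exists u, forall k i j, i < j ->
        D [set n | phi n (h u k i n) <= h u k j n].
Proof.
have [w0 _] := reg_nonempty Lam_reg.
have [Z [Zsmall Zgood]] := good_ladders_exist w0.
have [| | |E0 [_ E0P]] := @guessing V Lam (Lam * V)%type Z (@club Lam)
    (good_ladders w0) V_reg.
- by move=> B E; exact: club_cap.
- exact: Zsmall.
- exact: Zgood.
have bP u k : exists a : L k -> Lam, good_ladders w0 (Z u `&` E0) ->
   [/\ forall i j, i < j -> a i < a j, forall i, (Z u `&` E0) (a i) &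
    forall i j, i < j -> exists b, b < a j /\
      lt_mod D (hull w0 [set a i' | i' in [set i' | i' <= i]]) (F b)].
  have [H|H] := pselect (good_ladders w0 (Z u `&` E0)); last by exists (fun=> w0).
  by have [a aP] := H k; exists a.
pose b u k := sval (cid (bP u k)).
exists (fun u k i => hull w0 [set b u k i' | i' in [set i' | i' <= i]]); split.
  move=> u k n i j kn ij; apply: hull_le; first exact: image_small.
  by move=> _ [i' i'i <-]; exists i' => //=; exact: le_trans ij.
move=> phi phi_mono.
have /choice[psi psiP] : forall a, exists c, lt_mod D (fun n => phi n (F a n)) (F c).
  by move=> a; exact: F_cof.
have [|u [Gu uE]] := E0P (closure_pts psi); first by exists psi.
exists u => k i j ij; have [bI bE /(_ i j ij)[c [cj hc]]] := svalP (cid (bP u k)) Gu.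
rewrite -/(b u k) in bI bE cj hc.
have psij : psi c < b u k j by exact: (uE _ (bE j) c cj).
(* Beyond [k] a piece of length at most [L k] is bounded in [L n], so [hull] is a true supremum. *)
have kD : D [set n | (k < n)%N] by apply: D_cobounded; exists k.+1.
apply: filterS (filterI (filterI hc (psiP c)) (filterI (F_incr psij) kD)).
move=> n [[/= h1 h2] [h3 kn]]; apply: le_trans (phi_mono _ _ _ (ltW h1)) _.
apply: le_trans (ltW (lt_trans h2 h3)) _.
by have [H _] := hullP w0 (@image_small k n [set i' | i' <= j] (b u k) kn);
  apply: H; exists j => /=.
Qed.

(* For almost all [n] modulo [D] (the set [N]), [phi n] is separated from every
   [i : L 2] on by some later [j]; since [L 2] is regular uncountable, the closure
   points of a common bound for these [j] form a club. *)
Lemma uniform_ladder_guessing :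
  exists h : (Lam * V) * (L 2 * L 1) -> L 0%N -> forall n, L n,
    (forall u n i j, (2 < n)%N -> i <= j -> h u i n <= h u j n) /\
    forall phi : forall n, L n -> L n,
      (forall n x y, x <= y -> phi n x <= phi n y) ->
      exists u, D [set n | (2 < n)%N /\
        forall i j, i < j -> phi n (h u i n) <= h u j n].
Proof.
have [h [h_mono hP]] := ladder_guessing.
have [a [a_mono aP]] := @club_guessing (L 0%N) (L 1) (L 2) (L_reg 1) (L_reg 2)
  (L_lt (ltnSn 1)) (L_lt (ltnSn 0)) (@L_nat 0).
exists (fun u i => h u.1 2 (a u.2 i)); split.
  by move=> u n i j n2 ij; apply: h_mono n2 _; exact: a_mono.
move=> phi phi_mono; have [u {}hP] := hP phi phi_mono.
pose next n (i j : L 2) := i < j /\ phi n (h u 2 i n) <= h u 2 j n.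
pose N := [set n | (2 < n)%N /\ forall i, exists j, next n i j].
have DN : D N.
  have [w0 _] := reg_nonempty (L_reg 2).
  (* If some point has no [next] at [n], then [i n] is such a point. All [i n] lie below one [i0];
     where [phi] is separated from [i0] to [j], this [j] would be [next] to [i n]. *)
  have /choice[i iP] : forall n, exists i, ~ (forall i, exists j, next n i j) ->
      ~ exists j, next n i j.
    move=> n; have [/existsNP[i ?]|H] := pselect (~ forall i, exists j, next n i j).
      by exists i.
    by exists w0 => /H.
  have [i0 ii0] := reg_bound (L_reg 2) i (@L_nat 1).
  have [j i0j] := reg_gt (L_reg 2) i0.
  have D2 : D [set n | (2 < n)%N] by apply: D_cobounded; exists 3.
  apply: filterS (filterI D2 (hP 2 i0 j i0j)) => n [/= n2 ij]; split=> //.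
  apply: contrapT => /iP; apply; exists j; split; first exact: lt_trans i0j.
  by apply: le_trans ij; apply/phi_mono/h_mono => //; exact: ltW.
have /choice[psi psiP] : forall i, exists y, forall n, N n ->
    exists j, next n i j /\ j < y.
  move=> i; have /choice[g gP] : forall n, exists j, N n -> next n i j.
    move=> n; have [[n2 /(_ i)[j ?]]|H] := pselect (N n); first by exists j.
    by exists i.
  have [y yP] := reg_bound (L_reg 2) g (@L_nat 1).
  by exists y => n /gP gn; exists (g n).
have [|s [sI sE]] := aP (closure_pts psi); first by exists psi.
exists (u, s); apply: filterS DN => n Nn; split=> [|i j ij /=]; first by case: Nn.
have [k [[_ ik] kpsi]] := psiP (a s i) n Nn.
apply: (le_trans ik); apply: h_mono; first by case: Nn.
exact: ltW (lt_trans kpsi (sE j _ (sI i j ij))).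
Qed.

End Scale.

(** * Trees *)

Section Levels.
Variables (d : Order.disp_t) (T : porderType d).

Lemma at_level_card (x : T) i : at_level x i -> below i #= [set y | y < x].
Proof.
move=> [f [fm <-]]; rewrite card_eq_sym; apply: inj_card_eq => j k ji ki fjk.
have := fm j k ji ki; have := fm k j ki ji; rewrite fjk ltxx.
by case: ltngtP.
Qed.

(** Distinct ordinals up to omega have distinct cardinalities, so counting predecessors is
    enough. *)
Lemma at_level_inj (x : T) i j : at_level x i -> at_level x j -> i = j.
Proof.
move=> /at_level_card xi /at_level_card xj.
have : below i #= below j by apply: card_eq_trans xi _; rewrite card_eq_sym.
have inf n : `I_n #= [set: nat] -> False.
  by move=> /eq_finite_set E; apply: infinite_nat; rewrite -E; exact: finite_II.
case: i j {xi xj} => [m|] [n|] //=; first by move=> /card_eq_II ->.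
- by move/inf.
- by rewrite card_eq_sym => /inf.
Qed.

(* The predecessors of [y] form a chain with one element per level. *)
Lemma pred_at_level_inj (y z z' : T) i n : at_level y i -> z < y -> z' < y ->
  at_level z (Fin n) -> at_level z' (Fin n) -> z = z'.
Proof.
move=> [f [fm fy]] zy z'y zn z'n.
have flev j : below i j -> at_level (f j) (Fin j).
  move=> ij; have lt_below k : (k < j)%N -> below i k.
    by case: (i) ij => //= m jm kj; exact: ltn_trans jm.
  exists f; split.
    move=> k l; rewrite !inE /= => kj lj; apply: fm; rewrite inE; exact: lt_below.
  apply/predeqP => w; split=> [[k kj <-]|wf] /=.
    by rewrite fm ?inE //; exact: lt_below.
  have : [set w | w < y] w.
    apply: (lt_trans wf); have : (f @` below i) (f j) by exists j.
    by rewrite fy.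
  rewrite -fy => -[k ik wk]; exists k => //=.
  by move: wf => /=; rewrite -wk fm ?inE.
have : (f @` below i) z /\ (f @` below i) z' by rewrite fy.
move=> [[j ij zj] [k ik zk]]; subst z z'.
have [jn] := at_level_inj (flev j ij) zn; have [kn] := at_level_inj (flev k ik) z'n.
by rewrite jn kn.
Qed.

End Levels.

Section Tree.
Variables (L : nat -> cardinal) (b : forall n, L n) (X : set (forall n, L n)).
Local Notation P := (forall n, L n).

Definition trunc (n : nat) (p : P) : P := fun m => if (m <= n)%N then p m else b m.

Lemma trunc_trunc m n p : (m <= n)%N -> trunc m (trunc n p) = trunc m p.
Proof.
move=> mn; apply: functional_extensionality_dep => k; rewrite /trunc.
by case: ifP => // km; rewrite (leq_trans km mn).
Qed.

(* A node at a finite level [n] is a sequence of length [n.+1], represented by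
   its extension by [b]; the nodes at level omega are the elements of [X]. *)
Definition is_node (x : level * P) : Prop :=
  if x.1 is Fin n then trunc n x.2 = x.2 else X x.2.

Definition node := {x : level * P | is_node x}.

Definition node_lt (x y : node) : bool :=
  `[< exists n, [/\ (sval x).1 = Fin n, below (sval y).1 n &
    (sval x).2 = trunc n (sval y).2] >].

Lemma node_lt_irr : irreflexive node_lt.
Proof.
move=> x; apply/asboolP => -[n [xn + _]]; rewrite xn /=.
by rewrite ltnn.
Qed.

Lemma node_lt_trans : transitive node_lt.
Proof.
move=> y x z /asboolP[m [xm ym xy]] /asboolP[n [yn zn yz]]; apply/asboolP.
exists m; rewrite yn /= in ym; split=> //.
  by case: (sval z).1 zn => //= k nk; exact: ltn_trans nk.
by rewrite xy yz trunc_trunc // ltnW.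
Qed.

HB.instance Definition _ := gen_eqMixin node.
HB.instance Definition _ := gen_choiceMixin node.
HB.instance Definition _ :=
  Order.Lt_isPOrder.Build Order.default_display node node_lt_irr node_lt_trans.

Lemma is_node_trunc n p : is_node (Fin n, trunc n p).
Proof. by rewrite /is_node /= trunc_trunc. Qed.

Definition restr (p : P) (n : nat) : node := exist _ _ (is_node_trunc n p).

Lemma node_ltE (x y : node) :
  (x < y) <-> exists2 n, below (sval y).1 n & x = restr (sval y).2 n.
Proof.
split=> [/asboolP[n [xn yn xy]]|[n yn ->]]; last by apply/asboolP; exists n.
by exists n => //; apply: sval_inj => /=; rewrite -xn -xy; case: (sval x).
Qed.

Lemma node_at_level (x : node) : at_level x (sval x).1.
Proof.
exists (restr (sval x).2); split.
  move=> j k _ _; apply/idP/idP => [/node_ltE[n /= nk]|jk].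
    by case/(congr1 sval) => ->.
  apply/node_ltE; exists j => //; apply: sval_inj => /=.
  by rewrite trunc_trunc // ltnW.
by apply/predeqP => y; split=> [[j xj <-]|/node_ltE[n xn ->]];
  [apply/node_ltE; exists j|exists n].
Qed.

Lemma node_leveled (x : node) : exists i, at_level x i.
Proof. by exists (sval x).1; exact: node_at_level. Qed.

Definition node_tree : tree := Tree node_leveled.

Lemma node_levelE (x : node_tree) i : at_level x i -> (sval x).1 = i.
Proof. exact: at_level_inj (node_at_level x). Qed.

Hypothesis L_reg : forall n, regular (L n).
Hypothesis L_lt : forall m n, (m < n)%N -> ~ emb (L n) (L m).
Hypothesis L_incr : forall n, emb (L n) (L n.+1).

Lemma small_prod (W : cardinal) A B : regular W ->
  ~ emb W A -> ~ emb W B -> ~ emb W (A * B).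
Proof.
move=> W_reg WA WB [f fI]; have [w0 _] := reg_nonempty W_reg.
have /choice[g gP] : forall p, exists w, forall w', f w' = p -> w' = w.
  move=> p; have [[w <-]|H] := pselect (exists w, f w = p).
    by exists w => w' /fI.
  by exists w0 => w' wp; case: H; exists w'.
have [x xP] := reg_bound2 W_reg (fun a c => g (a, c)) WA (fun=> WB).
have := xP (f x).1 (f x).2; rewrite -surjective_pairing.
by rewrite -(gP _ x erefl) ltxx.
Qed.

Lemma small_le (W : cardinal) (a : W) : regular W -> ~ emb W {c | c <= a}.
Proof.
move=> W_reg; have [a' aa'] := reg_gt W_reg a.
apply: small_emb (@seg_small W a') _; apply: emb_sub => c ca.
exact: le_lt_trans ca aa'.
Qed.

Lemma emb_trunc_step n (A : set P) : A `<=` [set p | trunc n.+1 p = p] ->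
  emb {p | A p} ({p | trunc n p = p} * {c | exists2 p, A p & p n.+1 = c}).
Proof.
move=> Atr.
have t1 (p : {p | A p}) : trunc n (trunc n (sval p)) = trunc n (sval p).
  exact: trunc_trunc.
have t2 (p : {p | A p}) : exists2 q, A q & q n.+1 = sval p n.+1.
  by exists (sval p) => //; exact: svalP.
exists (fun p => (exist (fun q => trunc n q = q) _ (t1 p),
  exist (fun c => exists2 q, A q & q n.+1 = c) _ (t2 p))) => p q [pq pqn].
apply: sval_inj; have := Atr _ (svalP q); have := Atr _ (svalP p) => /= <- <-.
apply: functional_extensionality_dep => m; rewrite /trunc leq_eqVlt ltnS.
case: eqP => [->//|_ /=]; have := congr1 (fun f => f m) pq.
by rewrite /trunc; case: ifP.
Qed.

Lemma emb_level n : emb {p | trunc n p = p} (L n).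
Proof.
elim: n => [|n IH].
  exists (fun p => sval p 0%N) => p q pq; apply: sval_inj.
  rewrite -(svalP p) -(svalP q); apply: functional_extensionality_dep => m.
  by rewrite /trunc leqn0; case: eqP => // ->.
apply: emb_trans (emb_square (reg_inf (L_reg n.+1))).
apply: emb_trans (emb_trunc_step (fun=> id)) _.
exact: emb_prod (emb_trans IH (L_incr n)) (emb_sig _).
Qed.

(** This makes it possible to bound the images of all nodes at positions up to [a]. The last
    coordinate ranges over an initial segment, the earlier ones over fewer than [L n] sequences. *)
Lemma small_level n (a : L n) : ~ emb (L n) {p | trunc n p = p /\ p n <= a}.
Proof.
case: n a => [|n] a.
  apply: small_emb (@small_le _ a (L_reg 0%N)) _.
  exists (fun p => exist (fun c => c <= a) _ (proj2 (svalP p))) => p q [pq].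
  apply: sval_inj; rewrite -(proj1 (svalP p)) -(proj1 (svalP q)).
  apply: functional_extensionality_dep => m.
  by rewrite /trunc leqn0; case: eqP => // ->.
have H := small_prod (L_reg n.+1)
  (small_emb (L_lt (ltnSn n)) (emb_level n)) (@small_le _ a (L_reg n.+1)).
apply: small_emb H _.
apply: emb_trans (@emb_trunc_step n [set p | trunc n.+1 p = p /\ p n.+1 <= a] _) _.
  by move=> p [].
apply: emb_prod (emb_refl _) _; apply: emb_sub => _ [p [_ pa] <-] //.
Qed.

End Tree.

Lemma level_index (lam : level -> cardinal) (U : tree) (n : nat) :
  (forall i, regular (lam i)) -> Ktr lam U ->
  exists idx : U -> lam (Fin n), forall x y, at_level x (Fin n) ->
    at_level y (Fin n) -> idx x = idx y -> x = y.
Proof.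
move=> lam_reg /(_ (Fin n))/card_leTrE[f fI].
have [w0 _] := reg_nonempty (lam_reg (Fin n)).
have /choice[g gP] : forall x, exists c, forall h : at_level x (Fin n),
    c = f (exist (fun x => at_level x (Fin n)) x h).
  move=> x; have [h|nh] := pselect (at_level x (Fin n)); last by exists w0.
  exists (f (exist (fun x => at_level x (Fin n)) x h)) => h'.
  by congr f; exact: sval_inj.
exists g => x y xn yn; rewrite (gP x xn) (gP y yn) => /fI.
by move=> /(congr1 sval).
Qed.

(* To each index [u] we attach a pattern [eta u] that no top element of [U]
   matches; the tree whose top elements are the [x u H (eta u)] cannot be
   embedded, because [phi] is chosen so that the embedding moves positions by
   less than [phi], in either direction. *)
Lemma no_universal (lam : level -> cardinal) (Ix Hx Br : Type)
    (x : Ix -> Hx -> Br -> forall n, lam (Fin n))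
    (M : Ix -> Hx -> Br -> (forall n, lam (Fin n)) -> Prop) :
  (forall i, regular (lam i)) ->
  (forall m n, (m < n)%N -> ~ emb (lam (Fin n)) (lam (Fin m))) ->
  (forall n, emb (lam (Fin n)) (lam (Fin n.+1))) ->
  emb Ix (lam Omega) -> emb Hx (lam Omega) -> ~ emb Br (lam Omega) ->
  (forall u H eta eta' g, M u H eta g -> M u H eta' g -> eta = eta') ->
  (forall phi : forall n, lam (Fin n) -> lam (Fin n),
    (forall n a c, a <= c -> phi n a <= phi n c) ->
    exists u, forall eta, exists H, forall g,
      (forall n a, (x u H eta n <= a -> g n < phi n a) /\
        (g n <= a -> x u H eta n < phi n a)) -> M u H eta g) ->
  ~ exists U, universal lam U.
Proof.
move=> lam_reg L_lt L_incr IxLam HxLam BrLam Minj Mex [U [KU Uuniv]].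
pose L n := lam (Fin n); have L_reg n : regular (L n) by exact: lam_reg.
have idxP n := cid (level_index n lam_reg KU).
pose idx n := sval (idxP n).
have idx_inj n : forall y z, at_level y (Fin n) -> at_level z (Fin n) ->
    idx n y = idx n z -> y = z := svalP (idxP n).
pose path (y : U) (g : forall n, L n) :=
  forall n, exists z, [/\ z < y, at_level z (Fin n) & g n = idx n z].
have LamLam : emb (lam Omega * lam Omega) (lam Omega).
  by apply: emb_square; exact: reg_inf.
(* Otherwise every pattern is matched by some top element and some [H]. The top element determines
   the path, and the path with [H] the pattern, so [Br] would embed in [lam Omega]. *)
have /choice[eta etaP] : forall u, exists eta, forall (y : U) H g,
    at_level y Omega -> path y g -> ~ M u H eta g.
  move=> u; apply: contrapT => /forallNP noeta; apply: BrLam.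
  have /choice[f fP] : forall eta, exists p : {y : U | at_level y Omega} * Hx,
      exists g, path (sval p.1) g /\ M u p.2 eta g.
    move=> eta; have /existsNP[y /existsNP[H /existsNP[g]]] := noeta eta.
    move=> /not_implyP[yO /not_implyP[yg /contrapT Mg]].
    by exists (exist _ y yO, H), g.
  apply: emb_trans LamLam; apply: emb_trans (emb_prod _ HxLam); last first.
    exact/card_leTrE/(KU Omega).
  exists f => eta1 eta2 f12; have [g1 [p1 M1]] := fP eta1.
  have [g2 [p2 M2]] := fP eta2; rewrite -f12 in p2 M2.
  apply: Minj M1 _; suff -> : g1 = g2 by [].
  apply: functional_extensionality_dep => n.
  have [z1 [z1y z1n ->]] := p1 n; have [z2 [z2y z2n ->]] := p2 n.
  congr (idx n _).
  exact: pred_at_level_inj (svalP (f eta1).1) z1y z2y z1n z2n.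
pose b n : L n := sval (cid (reg_nonempty (L_reg n))).
pose X := [set p | exists u H, p = x u H (eta u)].
pose T := node_tree b X.
have KT : Ktr lam T.
  move=> i; apply/card_leTrE; case: i => [n|].
    apply: emb_trans (emb_level b L_reg L_incr n).
    have H (y : {y : T | at_level y (Fin n)}) :
        trunc b n (sval (sval y)).2 = (sval (sval y)).2.
      by have := svalP (sval y); rewrite /is_node (node_levelE (svalP y)).
    exists (fun y => exist (fun p => trunc b n p = p) _ (H y)) => y z [yz].
    do 2!apply: sval_inj; move: yz.
    have := node_levelE (svalP y); have := node_levelE (svalP z).
    by case: (sval (sval y)) (sval (sval z)) => [? ?] [? ?] /= -> -> ->.
  have H (y : {y : T | at_level y Omega}) :
      exists p, (sval (sval y)).2 = x p.1 p.2 (eta p.1).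
    have := svalP (sval y); rewrite /is_node (node_levelE (svalP y)).
    by move=> [u [H ->]]; exists (u, H).
  have /choice[f fP] := H.
  apply: emb_trans LamLam; apply: emb_trans (emb_prod IxLam HxLam).
  exists f => y z fyz; do 2!apply: sval_inj.
  have := node_levelE (svalP y); have := node_levelE (svalP z).
  have : (sval (sval y)).2 = (sval (sval z)).2 by rewrite !fP fyz.
  by case: (sval (sval y)) (sval (sval z)) => [? ?] [? ?] /= -> -> ->.
have [h [h_inj h_lt h_lev]] := Uuniv T KT.
pose pos n p := idx n (h (restr b X p n)).
have h_level n p : at_level (h (restr b X p n)) (Fin n).
  exact: h_lev (node_at_level (restr b X p n)).
have pos_inj n p q : trunc b n p = p -> trunc b n q = q -> pos n p = pos n q -> p = q.
  move=> pn qn /idx_inj => /(_ (h_level _ _) (h_level _ _)) /h_inj.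
  by move=> /(congr1 (fun y => (sval y).2)) /=; rewrite pn qn.
pose Phi n a c := forall p, trunc b n p = p ->
  (p n <= a -> pos n p < c) /\ (pos n p <= a -> p n < c).
(* The least bound is taken in order to make [phi] nondecreasing. *)
have phi_ex n a : exists c, Phi n a c /\ forall c', Phi n a c' -> c <= c'.
  apply: wo_least.
  have [c cP] := reg_bound (L_reg n)
    (fun p : {p | trunc b n p = p /\ p n <= a} => pos n (sval p))
    (small_level L_reg L_lt L_incr (a := a)).
  have [|c' c'P] := reg_bound (L_reg n)
      (fun p : {p | trunc b n p = p /\ pos n p <= a} => sval p n).
    apply: small_emb (@small_le _ a (L_reg n)) _.
    exists (fun p => exist (fun c => c <= a) _ (proj2 (svalP p))) => p q [pq].
    apply: sval_inj; exact: pos_inj (proj1 (svalP p)) (proj1 (svalP q)) pq.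
  exists (Order.max c c') => p pn; split=> pa; rewrite lt_max.
    by rewrite (cP (exist _ p (conj pn pa))).
  by rewrite (c'P (exist _ p (conj pn pa))) orbT.
pose phi n a := sval (cid (phi_ex n a)).
have phiP n a : Phi n a (phi n a) := (svalP (cid (phi_ex n a))).1.
have [|u /(_ (eta u))[H HM]] := Mex phi.
  move=> n a c ac; apply: (svalP (cid (phi_ex n a))).2 => p pn.
  have [H1 H2] := phiP n c p pn.
  by split=> pa; [apply: H1|apply: H2]; exact: le_trans pa ac.
set p := x u H (eta u) in HM.
have pX : is_node b X (Omega, p) by exists u, H.
pose t : T := exist _ (Omega, p) pX.
apply: (etaP u (h t) H (fun n => pos n p)).
- exact: h_lev (node_at_level (t : node b X)).
- move=> n; exists (h (restr b X p n)); split=> //.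
  by rewrite h_lt; apply/node_ltE; exists n.
- apply: HM => n a; have := phiP n a (trunc b n p) (trunc_trunc b p (leqnn n)).
  suff -> : pos n (trunc b n p) = pos n p by rewrite /trunc leqnn.
  by congr (idx n (h _)); apply: sval_inj => /=; rewrite trunc_trunc.
Qed.

(** * Nonexistence of universal trees *)

(** A cofinal set smaller than [mu] would embed in [S] and cover [mu] by segments embedding in
    [S]. *)
Lemma successor_regular (S : Type) (mu : cardinal) :
  emb nat S -> is_successor S mu -> regular mu.
Proof.
move=> natS [/andP[/card_leTE Smu /negP nmuS] Sleast].
have muS : ~ emb mu S by move=> /card_leTE.
have small T (A : set T) : ~ emb mu {x | A x} -> emb {x | A x} S.
  move=> muA; have [//|SA] := emb_total {x | A x} S; apply: contrapT => AS.
  apply/muA/card_leTlE/Sleast; apply/andP; split; first exact/card_leTlE.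
  by apply/negP => /card_leTrE.
have SS : emb (S * S) S := emb_square natS.
split; first exact/infiniteP/card_leTE/(emb_trans natS).
move=> A Acof; apply: contrapT => /card_leTlE /small AS; apply: muS.
have [i iI] := natS.
have /choice[a aP] : forall x, exists a : {a | A a}, x <= sval a.
  by move=> x; have [a Aa xa] := Acof x; exists (exist _ a Aa).
have segS (y : mu) : emb {x | x < y} S by apply: small; exact: seg_small.
pose e y := sval (cid (segS y)).
have eI y : injective (e y) := svalP (cid (segS y)).
apply: (emb_trans _ SS); apply: (emb_trans _ (emb_prod (emb_refl S) SS)).
apply: emb_trans (emb_prod AS (emb_refl (S * S)%type)).
(* Since [a x] may equal [x], the tags [i 0] and [i 1] tell [x < a x] from [x = a x]. *)
exists (fun x => (a x, if pselect (x < sval (a x)) is left xa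
  then (i 0%N, e (sval (a x)) (exist _ x xa)) else (i 1%N, i 0%N))).
move=> x y [axy]; have := aP y; have := aP x; rewrite axy.
case: pselect => [xa|/negP]; case: pselect => [ya|/negP].
- by move=> _ _ [/eI[]].
- by move=> _ _ _ [/iI].
- by move=> _ _ _ [/iI].
- by rewrite -!leNgt => ya xa xa' ya' _; apply/eqP; rewrite eq_le
    (le_trans xa' ya) (le_trans ya' xa).
Qed.

Lemma emb_Tagged (I : eqType) (T : I -> Type) (i : I) : emb (T i) {i & T i}.
Proof.
exists (Tagged T) => x y xy; have := congr1 (tagged_as (Tagged T x)) xy.
by rewrite !tagged_asE.
Qed.

Lemma emb_nat_fun : emb (nat -> nat) (nat -> bool).
Proof.
exists (fun f c => if unpickle c is Some (n, m) then f n == m else false).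
move=> f g fg; apply/funext => n; have := congr1 (fun p => p (pickle (n, f n))) fg.
by rewrite /= pickleK eqxx => /esym/eqP.
Qed.

Lemma pick_inj (B : nat -> set nat) :
  (forall k m, exists n, B k n /\ (m < n)%N) ->
  exists2 H : nat -> nat, injective H & forall k, B k (H k).
Proof.
move=> BP; have /choice[f fP] : forall p : nat * nat,
    exists n, B p.1 n /\ (p.2 < n)%N by move=> p; exact: BP.
pose H := fix H k := if k is k'.+1 then f (k, H k') else f (0%N, 0%N).
exists H; last by case=> [|k]; exact: (fP (_, _)).1.
have Hlt : {homo H : m n / (m < n)%N}.
  by apply: homo_ltn; [exact: ltn_trans|move=> k; exact: (fP (_, _)).2].
move=> m n Hmn; case: (ltngtP m n) => // /Hlt; by rewrite Hmn ltnn.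
Qed.

(** With [s] a double step, each label has three rungs of its own: a lower bound, a place for the
    top element and an upper bound. *)
Lemma spaced_labels (W : cardinal) (s : W -> W) : regular W ->
  exists d : W -> W, forall j i, j < i -> s (d j) <= d i.
Proof.
move=> W_reg; have [||||d [_ dP _]] := @rec_chain W W W_reg (@seg_small W) setT
    (fun d j x => s (d j) <= x).
- by move=> x; have [y xy] := reg_gt W_reg x; exists y.
- by move=> d d' j x dd'; rewrite dd'.
- by move=> d j x y xy dx; exact: le_trans xy.
- by move=> d j; exists (s (d j)).
by exists d => j i /dP[].
Qed.

(** Taking [a] to be [mid] gives the upper bound; [g <= lo] would give [mid < phi lo]. *)
Lemma moved_between (W : cardinal) (phi : W -> W) (lo mid hi g : W) :
  (forall a, (mid <= a -> g < phi a) /\ (g <= a -> mid < phi a)) ->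
  phi lo <= mid -> phi mid <= hi -> lo < g < hi.
Proof.
move=> gP lomid midhi; rewrite (lt_le_trans ((gP mid).1 (lexx _)) midhi) andbT.
rewrite ltNge; apply/negP => /(gP lo).2; by rewrite ltNge lomid.
Qed.

Section Universal.
Variable lam : level -> cardinal.
Local Notation L := (fun n => lam (Fin n)).
Local Notation Lam := (lam Omega).
Variables (V : cardinal) (D : set_system nat).
Hypothesis lam_reg : forall i, regular (lam i).
Hypothesis V_reg : regular V.
Hypothesis L_lt : forall m n, (m < n)%N -> ~ emb (L n) (L m).
Hypothesis L_incr : forall n, emb (L n) (L n.+1).
Hypothesis L_nat : forall n, ~ emb (L n.+1) nat.
Hypothesis L_V : forall n, emb (L n) V.
Hypothesis V_L : forall n, ~ emb V (L n).
Hypothesis V_Lam : emb V Lam.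
Hypothesis Lam_V : ~ emb Lam V.
Hypothesis D_filter : ProperFilter D.
Hypothesis D_cobounded : forall A : set nat, cobounded A -> D A.
Variable F : Lam -> forall n, L n.
Hypothesis F_incr : forall a b, a < b -> lt_mod D (F a) (F b).
Hypothesis F_cof : forall g : forall n, L n, exists a, lt_mod D g (F a).

Let Lam2 : emb (Lam * Lam) Lam.
Proof. by apply: emb_square; exact: reg_inf. Qed.

Let LamV : emb (Lam * V) Lam.
Proof. exact: emb_trans (emb_prod (emb_refl _) V_Lam) Lam2. Qed.

Let D_gt m : D [set n | (m < n)%N].
Proof. by apply: D_cobounded; exists m.+1. Qed.

Let next (W : cardinal) (W_reg : regular W) : W -> W :=
  fun x => sval (cid (reg_gt W_reg x)).

Let next_lt (W : cardinal) (W_reg : regular W) x : x < next W_reg x.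
Proof. exact: svalP (cid (reg_gt W_reg x)). Qed.

(* Patterns are sequences of zeroes and ones; at coordinate [n] the pattern is
   read off modulo [D] from the label that codes its first [n] terms. *)
Lemma no_universal_few : ~ emb (nat -> bool) Lam -> ~ exists U, universal lam U.
Proof.
move=> BrLam.
have [h [h_mono hP]] := uniform_ladder_guessing (fun n => lam_reg (Fin n))
  (lam_reg Omega) V_reg L_lt L_nat L_V V_L Lam_V D_filter D_cobounded F_incr F_cof.
have [w0 _] := reg_nonempty (lam_reg (Fin 0)).
pose t m := iter m (next (lam_reg (Fin 0))) w0.
have t_lt m n : (m < n)%N -> t m < t n.
  by apply: (homo_ltn (r := fun a b => a < b)) => [y x z|i];
    [exact: lt_trans|exact: next_lt].
pose code (eta : nat -> bool) n := pickle (mkseq eta n).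
(* The factor 3 reserves rungs 0, 1 and 2 of each label for lower bound, top element and upper
   bound. *)
pose lad u eta i n := h u (t (3 * code eta n + i)%N) n.
apply: (@no_universal lam _ unit (nat -> bool) (fun u _ eta n => lad u eta 1%N n)
  (fun u _ eta g => D [set n | (2 < n)%N /\ lad u eta 0%N n < g n < lad u eta 2 n]))
  => //.
- apply: emb_trans LamV; apply: emb_trans (emb_prod LamV (emb_refl V)).
  apply: (emb_prod (emb_refl _)); apply: emb_trans (emb_square (reg_inf V_reg)).
  exact: emb_prod (L_V _) (L_V _).
- by have [a0 _] := reg_nonempty (lam_reg Omega); exists (fun=> a0) => -[] [].
- move=> u _ eta eta' g M1 M2; apply/funext => m; apply: contrapT => neq.
  have [n [[[n2 /andP[g1 g2]] [_ /andP[g3 g4]]] mn]] :=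
    filter_ex (filterI (filterI M1 M2) (D_gt m)).
  have neqc : code eta n != code eta' n.
    apply/eqP => /(pcan_inj pickleK) /(congr1 (fun s => nth false s m)).
    by rewrite !nth_mkseq.
  have sep e e' : (code e n < code e' n)%N -> lad u e 2 n <= lad u e' 0%N n.
    move=> ee'; apply: h_mono n2 _; apply/ltW/t_lt.
    rewrite addn0; apply: leq_trans (leq_mul (leqnn 3) ee').
    by rewrite mulnS addnC ltn_add2r.
  move: neqc; rewrite neq_ltn => /orP[] /sep /(lt_le_trans _) H.
    by have := lt_trans g3 (H _ g2); rewrite ltxx.
  by have := lt_trans g1 (H _ g4); rewrite ltxx.
- move=> phi phi_mono; have [u uD] := hP phi phi_mono; exists u => eta; exists tt => g gP.
  apply: filterS uD => n [n2 nP]; split=> //.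
  by apply: moved_between (gP n) _ _; apply/nP/t_lt; rewrite ltn_add2l.
Qed.

(* Patterns are elements of the product of the [L k]; the [k]-th term is coded at
   a coordinate [H k] where the ladder is well separated at the label [eta k].
   This takes one top element for each [H]. *)
Lemma no_universal_many : emb (nat -> bool) Lam -> ~ emb (forall n, L n) Lam ->
  ~ exists U, universal lam U.
Proof.
move=> natLam BrLam.
have [h [h_mono hP]] := ladder_guessing (fun n => lam_reg (Fin n))
  (lam_reg Omega) V_reg L_lt L_nat L_V V_L Lam_V D_filter D_cobounded F_incr F_cof.
pose s k := next (lam_reg (Fin k)).
have s_lt k i : i < s k i by exact: next_lt.
have dP k := cid (spaced_labels (s k \o s k) (lam_reg (Fin k))).
pose d k := sval (dP k).
have d_sep k j i : j < i -> s k (s k (d k j)) <= d k i by exact: svalP (dP k) j i.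
pose lo u k i := h u k (d k i).
pose mid u k i := h u k (s k (d k i)).
pose hi u k i := h u k (s k (s k (d k i))).
(* Outside the range of [H] the value [eta n] is only a filler. *)
pose x u (H : nat -> nat) (eta : forall n, L n) n :=
  if pselect (exists k, H k = n) is left e
  then mid u (sval (cid e)) (eta (sval (cid e))) n else eta n.
apply: (@no_universal lam _ (nat -> nat) (forall n, L n) x
  (fun u H eta g => forall k, (k < H k)%N /\
    lo u k (eta k) (H k) < g (H k) < hi u k (eta k) (H k))) => //.
- exact: emb_trans emb_nat_fun natLam.
- move=> u H eta eta' g M1 M2; apply: functional_extensionality_dep => k.
  have [kH /andP[g1 g2]] := M1 k; have [_ /andP[g3 g4]] := M2 k.
  have sep i j : i < j -> hi u k i (H k) <= lo u k j (H k).
    by move=> ij; apply: h_mono kH _; exact: d_sep.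
  have [/sep H12|/sep H21|//] := ltgtP (eta k) (eta' k).
    by have := lt_trans g3 (lt_le_trans g2 H12); rewrite ltxx.
  by have := lt_trans g1 (lt_le_trans g4 H21); rewrite ltxx.
- move=> phi phi_mono; have [u uD] := hP phi phi_mono; exists u => eta.
  pose B k := [set n | [/\ (k < n)%N, phi n (lo u k (eta k) n) <= mid u k (eta k) n &
    phi n (mid u k (eta k) n) <= hi u k (eta k) n]].
  (* Sets of [D] meet every final segment, so [H] can be made injective; then [x] shows the [k]-th
     term at [H k]. *)
  have [k m|H H_inj HB] := @pick_inj B.
    have [n [[kn mn] [n1 n2]]] := filter_ex (filterI (filterI (D_gt k) (D_gt m))
      (filterI (uD k _ _ (s_lt k (d k (eta k)))) (uD k _ _ (s_lt k (s k (d k (eta k))))))).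
    by exists n.
  exists H => g gP k; have [kH H1 H2] := HB k; split=> //.
  have xH : x u H eta (H k) = mid u k (eta k) (H k).
    rewrite /x; case: pselect => [e|[]]; last by exists k.
    by case: (cid e) => k' /= /H_inj ->.
  by apply: moved_between H1 H2; rewrite -xH; exact: gP.
Qed.

End Universal.

Theorem theorem7p1
  (lam : level -> cardinal)
  (lam_regular : forall i : level, regular (lam i))
  (lam_increasing : forall n : nat,
     card_lt [set: lam (Fin n)] [set: lam (Fin n.+1)] /\
     card_lt [set: lam (Fin n.+1)] [set: lam Omega])
  (D : set_system nat)
  (D_filter : ProperFilter D)
  (D_cobounded : forall A : set nat, cobounded A -> D A)
  (D_tcf : tcf_eq D (fun n => lam (Fin n)) (lam Omega))
  (mu : cardinal)
  (mu_succ : is_successor {n : nat & lam (Fin n)} mu)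
  (mu_lt : card_lt [set: mu] [set: lam Omega])
  (lam_lt_prod : card_lt [set: lam Omega] [set: forall n : nat, lam (Fin n)]) :
  ~ exists U : tree, universal lam U.
Proof.
have ltE A B : card_lt [set: A] [set: B] -> emb A B /\ ~ emb B A.
  by move=> /andP[/card_leTE AB /negP BA]; split=> // /card_leTE.
have L_incr n : emb (lam (Fin n)) (lam (Fin n.+1)).
  by have [/ltE[]] := lam_increasing n.
have L_step n : ~ emb (lam (Fin n.+1)) (lam (Fin n)).
  by have [/ltE[]] := lam_increasing n.
have L_le m n : (m <= n)%N -> emb (lam (Fin m)) (lam (Fin n)).
  elim: n => [|n IH]; first by rewrite leqn0 => /eqP ->; exact: emb_refl.
  rewrite leq_eqVlt => /orP[/eqP ->|/IH mn]; first exact: emb_refl.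
  exact: emb_trans mn (L_incr n).
have L_lt m n : (m < n)%N -> ~ emb (lam (Fin n)) (lam (Fin m)).
  by move=> mn nm; apply: (L_step m); exact: emb_trans (L_le _ _ mn) nm.
have L_nat n : ~ emb (lam (Fin n.+1)) nat.
  exact: small_emb (L_step n) (reg_inf (lam_regular (Fin n))).
have LS n : emb (lam (Fin n)) {n & lam (Fin n)} := emb_Tagged _ n.
have [Smu muS] := ltE _ _ mu_succ.1.
have mu_reg : regular mu.
  exact: successor_regular (emb_trans (reg_inf (lam_regular (Fin 0))) (LS 0%N)) mu_succ.
have [mu_Lam Lam_mu] := ltE _ _ mu_lt.
have L_mu n : emb (lam (Fin n)) mu := emb_trans (LS n) Smu.
have mu_L n : ~ emb mu (lam (Fin n)) := small_emb muS (LS n).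
have [_ prod_Lam] := ltE _ _ lam_lt_prod.
have [F [F_incr F_cof]] := D_tcf.
have [natLam|natLam] := pselect (emb (nat -> bool) (lam Omega)).
  exact: (no_universal_many lam_regular mu_reg L_lt L_incr L_nat L_mu mu_L mu_Lam
    Lam_mu D_filter D_cobounded F_incr F_cof).
exact: (no_universal_few lam_regular mu_reg L_lt L_incr L_nat L_mu mu_L mu_Lam
  Lam_mu D_filter D_cobounded F_incr F_cof).
Qed.
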